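(* Maker has a winning strategy for the $(1,1)$-percolation game on $\mathbb{Z}^2$. More generally, for all integers $p,d$ with $1\leq p<d$, Maker has a winning strategy for the $(p,p)$-percolation game on $\mathbb{Z}^d$.
   Context: The $(p,q)$-percolation game on $(\Lambda,v_0)$, where $\Lambda$ is an infinite connected (multi)graph, $v_0$ is a vertex of $\Lambda$ and $p,q$ are positive integers: two players, Maker and Breaker, play in alternating turns, with Maker playing first. Initially all edges of $\Lambda$ are marked as unsafe. On each of her turns, Maker marks $p$ unsafe edges as safe; on each of his turns, Breaker takes $q$ unsafe edges and deletes them from the graph. Breaker wins if at any time in the game the component containing $v_0$ (in the graph of edges not deleted) becomes finite. If Maker is able to ensure that $v_0$ remains in an infinite component indefinitely, then she is said to have a winning strategy. If $\Lambda$ is vertex-transitive, the choice of $v_0$ does not matter and one speaks of the $(p,q)$-percolation game on $\Lambda$. The graph $\mathbb{Z}^d$ has vertex set $\mathbb{Z}^d$, with two vertices joined by an edge if and only if they lie at Euclidean distance $1$ from each other. *)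

(* Defs.v *)
(* MathComp, with mathcomp-finmap and the classical sets of MathComp-Analysis. *)
From Stdlib Require Import Relations.
From mathcomp Require Import all_boot all_order all_algebra algC finmap.
From mathcomp Require Import boolp classical_sets functions cardinality.

Set Implicit Arguments.
Unset Strict Implicit.
Unset Printing Implicit Defensive.

Import Order.TTheory GRing.Theory Num.Theory.

Local Open Scope fset_scope.
Local Open Scope classical_set_scope.
Local Open Scope ring_scope.

(* Edges are objects of their own, so parallel edges are allowed; a loop is an
   edge with a single endpoint. *)
Record multigraph := Multigraph {
  vertex : choiceType;
  edge : choiceType;
  ends : edge -> {fset vertex};
  ends_card : forall e, (1 <= #|` ends e| <= 2)%N }.

Section Game.
Variable G : multigraph.

Definition adjacent (D : {fset edge G}) (x y : vertex G) : Prop :=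
  exists2 e : edge G, e \notin D & ends e = [fset x; y].

Definition component (D : {fset edge G}) (v0 : vertex G) : set (vertex G) :=
  [set v | clos_refl_trans (vertex G) (adjacent D) v0 v].

(* A round (m, b): Maker marks the edges of m as safe, then Breaker deletes the
   edges of b. Histories list the completed rounds in chronological order. *)
Definition history := seq ({fset edge G} * {fset edge G}).

Definition safe (h : history) : {fset edge G} := \bigcup_(r <- h) r.1.
Definition deleted (h : history) : {fset edge G} := \bigcup_(r <- h) r.2.

Definition unsafe (h : history) (e : edge G) : bool :=
  (e \notin safe h) && (e \notin deleted h).

Definition maker_legal (p : nat) (h : history) (m : {fset edge G}) : Prop :=
  #|` m| = p /\ forall e, e \in m -> unsafe h e.

(* Breaker answers m, so the edges of m are no longer unsafe. *)
Definition breaker_legal (q : nat) (h : history) (m b : {fset edge G}) : Prop :=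
  #|` b| = q /\ forall e, e \in b -> unsafe h e && (e \notin m).

Definition maker_strategy := history -> {fset edge G}.

(* The histories that can arise when Maker follows sigma and Breaker plays
   arbitrary legal moves. *)
Inductive consistent (q : nat) (sigma : maker_strategy) : history -> Prop :=
| consistent_nil : consistent q sigma [::]
| consistent_rcons h b :
    consistent q sigma h -> breaker_legal q h (sigma h) b ->
    consistent q sigma (rcons h (sigma h, b)).

(* Maker's turns leave the set of deleted edges unchanged, so it suffices to
   inspect the component of v0 between rounds. *)
Definition winning_strategy (p q : nat) (v0 : vertex G)
    (sigma : maker_strategy) : Prop :=
  forall h, consistent q sigma h ->
    maker_legal p h (sigma h) /\ infinite_set (component (deleted h) v0).

End Game.

Definition maker_has_winning_strategy
    (G : multigraph) (p q : nat) (v0 : vertex G) : Prop :=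
  exists sigma : maker_strategy G, winning_strategy p q v0 sigma.

Arguments maker_has_winning_strategy : clear implicits.

Definition euclidean_dist (d : nat) (x y : 'rV[int]_d) : algC :=
  sqrtC (\sum_(i < d) (x 0 i - y 0 i)%:~R ^+ 2).

Definition Zd_is_edge (d : nat) (e : {fset 'rV[int]_d}) : bool :=
  `[< exists x y, e = [fset x; y] /\ euclidean_dist x y = 1 >].

Definition Zd_edge (d : nat) := {e : {fset 'rV[int]_d} | Zd_is_edge e}.

Lemma Zd_edge_card (d : nat) (e : Zd_edge d) : (1 <= #|` val e| <= 2)%N.
Proof.
by case: e => e /= /asboolP [x [y [-> _]]]; rewrite cardfs2; case: (x != y).
Qed.

Definition Zd_graph (d : nat) : multigraph := Multigraph (@Zd_edge_card d).

(* Main.v *)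
(** Call a set of edges escaping if some edge of it leaves every nonempty finite
    vertex set. Maker maintains p+1 escaping edge sets that avoid the deleted
    edges and pairwise meet only in safe edges; initially these are the lines of
    Z^d in p+1 coordinate directions. Since p deleted edges hit at most p of the
    sets, one set T is intact after Breaker's turn, and each deleted edge of
    another set can be replaced by one edge of T, which Maker marks as safe. A
    finite component of v0 would be left by an undeleted edge of any of the sets. *)
Require Import Defs.
From Stdlib Require Import Relations.
From mathcomp Require Import all_boot all_order all_algebra.
From mathcomp Require Import algC finmap boolp classical_sets cardinality.

Set Implicit Arguments.
Unset Strict Implicit.
Unset Printing Implicit Defensive.

Import GRing.Theory Num.Theory.

(** * Escaping edge sets and the exchange of a single edge *)

Section Escaping.
Variable G : multigraph.
Implicit Types (S T : set (edge G)) (C D : {fset vertex G}).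
Implicit Types (A X F : {fset edge G}).
Local Open Scope fset_scope.

Definition crosses (e : edge G) C : Prop :=
  exists x y, [/\ ends e = [fset x; y], x \in C & y \notin C].

Lemma fset2_eq (K : choiceType) (x y x' y' : K) : [fset x; y] = [fset x'; y'] ->
  (x = x' /\ y = y') \/ (x = y' /\ y = x').
Proof.
move=> E.
have /fset2P xP : x \in [fset x'; y'] by rewrite -E !inE eqxx.
have /fset2P yP : y \in [fset x'; y'] by rewrite -E !inE eqxx orbT.
have /fset2P x'P : x' \in [fset x; y] by rewrite E !inE eqxx.
have /fset2P y'P : y' \in [fset x; y] by rewrite E !inE eqxx orbT.
by case: xP yP x'P y'P => -> [] -> [] ? [] ?; auto.
Qed.

Lemma crossesE e x y C : ends e = [fset x; y] ->
  crosses e C <-> (x \in C) != (y \in C).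
Proof.
move=> E; split=> [[x' [y' [E' x'C y'C]]]|].
  have : [fset x; y] = [fset x'; y'] by rewrite -E.
  by case/fset2_eq=> -[-> ->]; rewrite x'C (negbTE y'C).
case: (boolP (x \in C)) => xC; case: (boolP (y \in C)) => yC // _.
  by exists x, y.
by exists y, x; split; rewrite // fsetUC.
Qed.

(** Endpoints that agree on [C] and on [C'] agree on every Boolean combination of the two. *)
Lemma crosses_combine (op : bool -> bool -> bool) e C C' D :
  (forall z, (z \in D) = op (z \in C) (z \in C')) ->
  crosses e D -> crosses e C \/ crosses e C'.
Proof.
move=> DE [x [y [E xD yD]]].
have [xyC|] := eqVneq (x \in C) (y \in C); last by left; apply/(crossesE _ E).
have [xyC'|] := eqVneq (x \in C') (y \in C'); last by right; apply/(crossesE _ E).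
by move: xD yD; rewrite !DE xyC xyC' => ->.
Qed.

Definition escaping S : Prop :=
  forall C, C != fset0 -> exists2 e, S e & crosses e C.

(* If dropping [e] destroys escape, it does so at a single finite set: for two
   such sets, the union and the differences would be crossed by [e] as well. *)
Lemma escaping_exchange S T (e : edge G) : escaping S -> escaping T ->
  exists2 f, T f & escaping [set g | S g /\ g <> e \/ g = f].
Proof.
move=> escS escT.
have [[C C0 tightC]|noC] :=
  pselect (exists2 C, C != fset0 & forall g, S g -> g <> e -> ~ crosses g C).
  (* No edge of [S] other than [e] crosses [C], so the replacement must be an edge of [T] that
     does. *)
  have [f Tf fC] := escT C C0; exists f => // D D0.
  have [[g [Sg ge gD]]|tightD] := pselect (exists g, [/\ S g, g <> e & crosses g D]).
    by exists g => //; left.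
  exists f; first by right.
  suff -> : D = C by [].
  have {}tightD g : S g -> g <> e -> ~ crosses g D.
    by move=> Sg ge gD; apply: tightD; exists g.
  (* A nonempty set whose crossing edges all cross [C] or [D] can be left by [S] only along [e]. *)
  have cross_e E : E != fset0 ->
      (forall g, crosses g E -> crosses g C \/ crosses g D) -> crosses e E.
    move=> E0 ECD; have [g Sg gE] := escS E E0.
    have [<-//|/eqP ge] := pselect (g = e).
    by case: (ECD g gE) => [/(tightC g)|/(tightD g)] []// /eqP; rewrite (negbTE ge).
  have eC : crosses e C by apply: cross_e C0 _; auto.
  have [x [y [Ee _ _]]] := eC.
  have {}cross_e (op : bool -> bool -> bool) E : E != fset0 ->
      (forall z, (z \in E) = op (z \in C) (z \in D)) ->
      op (x \in C) (x \in D) != op (y \in C) (y \in D).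
    move=> E0 opE; rewrite -!opE; apply/(crossesE _ Ee)/cross_e => // g.
    exact: crosses_combine opE.
  have xyC := cross_e (fun c _ => c) C C0 (fun=> erefl).
  have xyD := cross_e (fun _ d => d) D D0 (fun=> erefl).
  have CD0 : C `|` D != fset0.
    by have [z zC] := fset0Pn _ C0; apply/fset0Pn; exists z; rewrite inE zC.
  have xyU := cross_e orb (C `|` D) CD0 (fun z => in_fsetU C D z).
  (* As [e] crosses [C], [D] and their union, one endpoint lies in both sets and the other in
     neither. Hence [e] crosses neither difference, and both differences are empty. *)
  apply/eqP; rewrite eqEfsubset -!fsetD_eq0; apply/andP; split.
    apply/negPn/negP => DC0.
    have := cross_e (fun c d => ~~ c && d) (D `\` C) DC0 (fun z => in_fsetD D C z).
    by move: xyC xyD xyU; do 4![case: (_ \in _)].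
  apply/negPn/negP => DC0.
  have := cross_e (fun c d => ~~ d && c) (C `\` D) DC0 (fun z => in_fsetD C D z).
  by move: xyC xyD xyU; do 4![case: (_ \in _)].
(* Here [S] without [e] still escapes, so any edge of [T] serves; a singleton yields one. *)
have /fset0Pn[x _] : ends e != fset0.
  by rewrite -cardfs_gt0; case/andP: (ends_card e).
have x0 : [fset x] != fset0 by apply/fset0Pn; exists x; rewrite inE.
have [f Tf _] := escT _ x0.
exists f => // C C0.
have [[g [Sg ge gC]]|noCg] := pselect (exists g, [/\ S g, g <> e & crosses g C]).
  by exists g => //; left.
by case: noC; exists C => // g Sg ge gC; apply: noCg; exists g.
Qed.

Lemma escaping_component S X v : escaping S -> (forall e, S e -> e \notin X) ->
  infinite_set (component X v).
Proof.
move=> escS SX /finite_fsetP[C CE].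
have inC z : z \in C <-> component X v z by rewrite CE.
have vC : v \in C by apply/inC/rt_refl.
have C0 : C != fset0 by apply/fset0Pn; exists v.
have [e /SX eX [x [y [Ee /inC xC /negP]]]] := escS C C0.
by apply; apply/inC; apply: rt_trans xC _; apply: rt_step; exists e.
Qed.

(** An edge leaving a finite set that contains all endpoints of edges of [X] cannot be in [X];
    adding [v] keeps that set nonempty. *)
Lemma escaping_fresh S (v : vertex G) X : escaping S -> exists e, e \notin X.
Proof.
move=> escS; pose C := v |` \bigcup_(e <- X) ends e.
have C0 : C != fset0 by apply/fset0Pn; exists v; rewrite !inE eqxx.
have [e _ [x [y [Ee _ yC]]]] := escS C C0.
exists e; apply/negP => eX; case/negP: yC; rewrite inE; apply/orP; right.
by apply/bigfcupP; exists e; rewrite ?eX // Ee !inE eqxx orbT.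
Qed.

(** Maker must mark exactly [p] edges, while a repair may need fewer; fresh edges make up the
    number. *)
Lemma escaping_pad S (v : vertex G) X F p : escaping S -> (#|` F| <= p)%N ->
  exists m, [/\ F `<=` m, #|` m| = p & forall e, e \in m -> (e \in F) || (e \notin X)].
Proof.
move=> escS; elim: p => [|p IHp] Fp.
  by exists F; split=> //; [apply/eqP; rewrite -leqn0 | move=> e ->].
have [Fp1|Fp1] := eqVneq #|` F| p.+1; first by exists F; split=> // e ->.
have [|m [Fm mp mX]] := IHp; first by rewrite -ltnS ltn_neqAle Fp1.
have [e] := escaping_fresh v (m `|` X) escS.
rewrite inE negb_or => /andP[em eX].
exists (e |` m); split.
- exact: fsubset_trans Fm (fsubsetU1 _ _).
- by rewrite cardfsU1 em mp.
- by move=> g; rewrite in_fset1U => /orP[/eqP->|/mX//]; rewrite eX orbT.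
Qed.

(** * Replacing deleted edges by edges of an intact set *)

Section Repair.
Variables (I : eqType) (i0 : I).
Implicit Types (U : I -> set (edge G)).

Definition overlaps_in U A : Prop :=
  forall i j e, U i e -> U j e -> i <> j -> e \in A.

(** Being outside [A], the edge [e] lies in at most one set [U j], and [j] is not [i0]. Exchanging
    it there for an edge [f] of [U i0] creates new overlaps only at [f] and keeps [U i0] available
    for later exchanges. *)
Lemma repair1 U A e : (forall i, escaping (U i)) -> overlaps_in U A ->
  e \notin A -> ~ U i0 e ->
  exists U' f, [/\ forall i, escaping (U' i), U i0 f, overlaps_in U' (f |` A),
    U' i0 = U i0 & forall i g, U' i g -> g <> e /\ (U i g \/ g = f)].
Proof.
move=> escU ovU eA e0.
have [[j Uje]|noj] := pselect (exists j, U j e); last first.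
  (* No set contains [e]; the exchange only supplies some edge of [U i0]. *)
  have [f Uf _] := escaping_exchange e (escU i0) (escU i0).
  exists U, f; split=> //.
    by move=> i j g Uig Ujg ij; rewrite in_fset1U (ovU i j) ?orbT.
  by move=> i g Uig; split; [move=> ge; apply: noj; exists i; rewrite -ge | left].
have [f Uf escj] := escaping_exchange e (escU j) (escU i0).
have fe : f <> e by move=> fe; apply: e0; rewrite -fe.
have ji0 : (i0 == j) = false by apply/eqP=> i0j; apply: e0; rewrite i0j.
pose U' i := if i == j then [set g | U j g /\ g <> e \/ g = f]%classic else U i.
have U'U i g : U' i g -> g <> e /\ (U i g \/ g = f).
  rewrite /U'; have [->|/eqP ij] := eqVneq i j.
    by case=> [[Ug ge]|->]; split=> //; [left | right].
  move=> Ug; split; last by left.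
  by move=> ge; rewrite ge in Ug; move: (ovU i j e Ug Uje ij); rewrite (negbTE eA).
exists U', f; split=> //.
- by move=> i; rewrite /U'; case: eqP.
- move=> i k g /U'U[_ [Uig|->]]; last by rewrite fset1U1.
  case/U'U=> _ [Ukg|-> _]; last by rewrite fset1U1.
  by move=> ik; rewrite in_fset1U (ovU i k) ?orbT.
- by rewrite /U' ji0.
Qed.

Lemma repair U A (s : seq (edge G)) :
  (forall i, escaping (U i)) -> overlaps_in U A ->
  (forall e, e \in s -> e \notin A /\ ~ U i0 e) ->
  exists U' F, [/\ forall i, escaping (U' i), (#|` F| <= size s)%N,
    overlaps_in U' (F `|` A), (forall f, f \in F -> U i0 f) &
    forall i g, U' i g -> g \notin s /\ (U i g \/ U i0 g)].
Proof.
elim: s U A => [|e s IHs] U A escU ovU sA.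
  exists U, fset0; split=> //; rewrite ?cardfs0 ?fset0U //.
  by move=> i g Ug; split=> //; left.
have [eA e0] := sA e (mem_head _ _).
have [U1 [f [escU1 Uf ovU1 U10 U1U]]] := repair1 escU ovU eA e0.
have [|U' [F [escU' Fs ovU' FU U'U]]] := IHs U1 (f |` A) escU1 ovU1.
  (* The remaining edges of [s] avoid [U i0], which contains [f], so they stay outside [A] enlarged
     by [f]. *)
  move=> g gs; have [|gA g0] := sA g; first by rewrite inE gs orbT.
  rewrite U10 in_fset1U negb_or gA andbT; split=> //.
  by apply/eqP=> gf; apply: g0; rewrite gf.
exists U', (f |` F); split=> //.
- rewrite cardfsU1 /=; apply: leq_trans (leq_add (leq_b1 _) Fs) _.
  by rewrite add1n.
- by rewrite -fsetUA fsetUCA.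
- by move=> g; rewrite in_fset1U => /orP[/eqP->//|/FU]; rewrite U10.
- move=> i g /U'U[gs]; rewrite U10 inE (negbTE gs) orbF => U1g.
  case: U1g => [/U1U[ge Ug]|Ug].
    by split; [apply/eqP | case: Ug => [|->]; [left | right]].
  by split; [apply/eqP=> ge; apply: e0; rewrite -ge | right].
Qed.

End Repair.
End Escaping.

(** * Maker's strategy from disjoint escaping sets *)

Section Strategy.
Variables (G : multigraph) (p : nat) (v0 : vertex G).
Local Open Scope fset_scope.
Implicit Types (h : history G) (m b : {fset edge G}).

Lemma safe_rcons h r : safe (rcons h r) = safe h `|` r.1.
Proof. by rewrite /safe -cats1 big_cat big_seq1. Qed.

Lemma deleted_rcons h r : deleted (rcons h r) = deleted h `|` r.2.
Proof. by rewrite /deleted -cats1 big_cat big_seq1. Qed.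

(** The invariant is taken between Maker's move [m] and Breaker's answer, so [m] already counts as
    safe. *)
Definition good_move h m : Prop :=
  exists U : 'I_p.+1 -> set (edge G),
    [/\ forall i, escaping (U i), overlaps_in U (safe h `|` m)
      & forall i e, U i e -> e \notin deleted h].

(** Pigeonhole: an edge of [b] is outside [A], hence in at most one of the [p.+1] sets, so [p] edges
    cannot hit them all. *)
Lemma missed_set (U : 'I_p.+1 -> set (edge G)) A b : overlaps_in U A ->
  #|` b| = p -> (forall e, e \in b -> e \notin A) ->
  exists i0, forall e, e \in b -> ~ U i0 e.
Proof.
move=> ovU bp bA; apply: contrapT => noi0.
have hit i : exists e : b, U i (val e).
  apply: contrapT => noe; apply: noi0; exists i => e eb Ue.
  by apply: noe; exists [` eb].
have [c cU] := choice hit.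
have c_inj : injective c.
  move=> i j cij; apply/eqP; apply: contraT => /eqP ij.
  have := ovU i j (val (c i)) (cU i).
  by rewrite {1}cij => /(_ (cU j) ij); rewrite (negbTE (bA _ (valP _))).
by have := leq_card c c_inj; rewrite card_ord -cardfE bp ltnn.
Qed.

Lemma good_response h m b : good_move h m -> breaker_legal p h m b ->
  exists m', maker_legal p (rcons h (m, b)) m' /\ good_move (rcons h (m, b)) m'.
Proof.
move=> [U [escU ovU Udel]] [bp bh].
have bA e : e \in b -> e \notin safe h `|` m.
  by move=> /bh /andP[/andP[es _] em]; rewrite inE negb_or es.
have [i0 bi0] := missed_set ovU bp bA.
have [|U' [F [escU' Fp ovU' FU U'U]]] := repair (s := b) escU ovU (i0 := i0).
  by move=> e eb; split; [exact: bA | exact: bi0].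
pose h' := rcons h (m, b).
have Fdel e : e \in F -> e \notin deleted h'.
  move=> /FU Ue; rewrite deleted_rcons inE negb_or (Udel _ _ Ue) /=.
  by apply/negP=> /bi0.
(* Some edges of [F] may already be safe, so only the others are marked; the padding must be unsafe
   too. *)
have [|m' [Fm' m'p m'X]] :=
    escaping_pad v0 (safe h' `|` deleted h') (escU i0) (F := F `\` safe h') (p := p).
  by rewrite -bp (leq_trans _ Fp) // fsubset_leq_card // fsubDset fsubsetUr.
exists m'; split.
  split=> // e /m'X /orP[|]; last by rewrite inE negb_or.
  by rewrite inE => /andP[es /Fdel ed]; apply/andP.
exists U'; split=> //.
- move=> i j e Ui Uj ij; rewrite inE; case: (boolP (e \in safe h')) => //= es.
  apply: (fsubsetP Fm'); rewrite inE es /=.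
  have := ovU' i j e Ui Uj ij; rewrite inE => /orP[//|eA].
  by case/negP: es; rewrite safe_rcons.
- move=> i e /U'U[eb Ue]; rewrite deleted_rcons inE negb_or eb andbT.
  by case: Ue; exact: Udel.
Qed.

Theorem disjoint_escaping_win (U : 'I_p.+1 -> set (edge G)) :
  (forall i, escaping (U i)) -> (forall i j e, U i e -> U j e -> i = j) ->
  maker_has_winning_strategy G p p v0.
Proof.
move=> escU disjU.
pose good h := [set m | maker_legal p h m /\ good_move h m]%classic.
(* Any good move will do. One exists after every consistent history, so the default [fset0] does not
   arise there. *)
pose sigma h := xget fset0 (good h); exists sigma.
suff good_sigma h : consistent p sigma h -> good h (sigma h).
  move=> h /good_sigma[legal [V [escV _ Vdel]]]; split=> //.
  exact: escaping_component (escV ord0) (Vdel ord0).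
elim=> [|{}h b _ [_ good_h] b_legal]; apply: xgetPex; last first.
  exact: good_response.
(* The initial sets are disjoint, so any [p] edges make a good first move. *)
have [|m [_ mp _]] := escaping_pad v0 fset0 (escU ord0) (F := fset0) (p := p).
  by rewrite cardfs0.
exists m; split.
  by split=> // e _; rewrite /unsafe /safe /deleted !big_nil !inE.
exists U; split=> //; last by move=> *; rewrite /deleted big_nil inE.
by move=> i j e Ui Uj []; exact: disjU Ui Uj.
Qed.

End Strategy.

(** * Coordinate directions in the integer lattice *)

Section Lattice.
Variable d : nat.
Local Open Scope fset_scope.
Local Open Scope ring_scope.
Implicit Types (i j : 'I_d) (x y : 'rV[int]_d).

Definition unit_vec i : 'rV[int]_d := delta_mx 0 i.

Definition direction i : set (edge (Zd_graph d)) :=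
  [set e : edge (Zd_graph d) |
    exists x, ends e = [fset x; x + unit_vec i] :> {fset 'rV[int]_d}]%classic.

Lemma unit_vecE i j : unit_vec i 0 j = (j == i)%:R.
Proof. by rewrite mxE eqxx. Qed.

Lemma unit_step_dist x i : euclidean_dist x (x + unit_vec i) = 1.
Proof.
rewrite /euclidean_dist (bigD1 i) //= big1 => [|j ji].
  by rewrite mxE unit_vecE eqxx opprD addNKr addr0 rmorphN sqrrN expr1n sqrtC1.
by rewrite mxE unit_vecE (negbTE ji) addr0 subrr expr0n.
Qed.

Lemma direction_edge i x :
  exists2 e : edge (Zd_graph d), direction i e &
    ends e = [fset x; x + unit_vec i] :> {fset 'rV[int]_d}.
Proof.
have edge_x : Zd_is_edge [fset x; x + unit_vec i].
  by apply/asboolP; exists x, (x + unit_vec i); split=> //; exact: unit_step_dist.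
by exists (Sub [fset x; x + unit_vec i] edge_x : Zd_edge d) => //; exists x.
Qed.

(** A finite set left by no edge of this direction would be closed under adding [unit_vec i], and so
    contain an infinite ray. *)
Lemma direction_escaping i : escaping (direction i).
Proof.
move=> C /fset0Pn[v vC]; apply: contrapT => stuck.
have step x : x \in C -> x + unit_vec i \in C.
  move=> xC; apply: contrapT => /negP yC; apply: stuck.
  have [e ei Ee] := direction_edge i x; exists e => //.
  by exists x, (x + unit_vec i).
have ray n : v + unit_vec i *+ n \in C.
  by elim: n => [|n IHn]; rewrite ?addr0 // mulrSr addrA step.
pose c (n : 'I_#|` C|.+1) : C := [` ray n].
have c_inj : injective c.
  move=> m n /(congr1 val) /= /addrI /matrixP /(_ 0 i).
  by rewrite !mulmxnE !unit_vecE eqxx => /eqP; rewrite eqr_nat => /eqP /val_inj.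
by have := leq_card c c_inj; rewrite card_ord -cardfE ltnn.
Qed.

Lemma direction_disjoint i j e : direction i e -> direction j e -> i = j.
Proof.
move=> [x Ex] [y Ey].
have /fset2_eq : [fset x; x + unit_vec i] = [fset y; y + unit_vec j].
  by rewrite -Ex -Ey.
case=> [[-> /addrI /matrixP /(_ 0 i)]|[->]].
  by rewrite !unit_vecE eqxx; case: eqP.
(* With opposite orientations [unit_vec j + unit_vec i] would vanish, but its coordinate [i] is
   positive. *)
rewrite -addrA -{2}[y]addr0 => /addrI /matrixP /(_ 0 i).
by rewrite !mxE !eqxx; case: (_ == _).
Qed.

End Lattice.

Lemma Zd_maker_win (p d : nat) (v0 : vertex (Zd_graph d)) : (p < d)%N ->
  maker_has_winning_strategy (Zd_graph d) p p v0.
Proof.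
(* [pd] also reads [p.+1 <= d], which provides [p.+1] distinct directions. *)
move=> pd; apply: (@disjoint_escaping_win _ _ _ (fun i => direction (widen_ord pd i))).
  by move=> i; exact: direction_escaping.
by move=> i j e Ui Uj; apply/val_inj; have /(congr1 val) := direction_disjoint Ui Uj.
Qed.

Theorem theorem1p2 :
  (forall v0 : vertex (Zd_graph 2),
     maker_has_winning_strategy (Zd_graph 2) 1 1 v0) /\
  (forall p d : nat, (1 <= p)%N -> (p < d)%N ->
   forall v0 : vertex (Zd_graph d),
     maker_has_winning_strategy (Zd_graph d) p p v0).
Proof.
by split=> [v0 | p d _ pd v0]; exact: Zd_maker_win.
Qed.
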